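(* Let $0<q<1$, let $r,s$ be nonnegative integers and $a_1,\dots,a_r,b_1,\dots,b_s\ge 0$ real numbers. For $x>0$ set $$f(x)=\frac{\prod_{i=1}^{r}\Gamma_q(x+a_i)}{\prod_{j=1}^{s}\Gamma_q(x+b_j)},\qquad F_n(x)=\frac{d^n}{dx^n}\log f(x),\qquad \Upsilon=\sum_{i=1}^r q^{a_i}-\sum_{j=1}^s q^{b_j}.$$ For each integer $n\ge 2$ there exists $M_n\ge 0$ such that $F_n(x)$ is monotone for $x>M_n$. More specifically, $F_n(x)$ has the same sign as $\Upsilon\,(\log q)^n$ (for $x>M_n$).
   Context: For $0<q<1$ and $x>0$, the $q$-gamma function is $\Gamma_q(x)=\frac{(q;q)_\infty}{(q^x;q)_\infty}(1-q)^{1-x}$, where $(a;q)_\infty=\prod_{k=0}^\infty(1-aq^k)$. Empty products equal $1$ and empty sums equal $0$.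
   Formalization: The same-sign claim is stated only for Υ ≠ 0: when Υ = 0, F_n(x) can be nonzero for all large x (e.g. r = s = 2, q^{a_i} = 1/2, 1/2, q^{b_j} = 1/4, 3/4); monotonicity is stated for every Υ. *)

(* Defs.v *)
From Stdlib Require Import Reals List.
From Coquelicot Require Import Coquelicot.
Open Scope R_scope.

(* (a; q)_oo, as the limit of the partial products. *)
Definition qPochhammer_inf (a q : R) : R :=
  real (Lim_seq (fun n => prod_f_R0 (fun k => 1 - a * q ^ k) n)).

Definition q_gamma (q x : R) : R :=
  qPochhammer_inf q q / qPochhammer_inf (Rpower q x) q * Rpower (1 - q) (1 - x).

(* u 1 * ... * u n, equal to 1 when n = 0; Stdlib's [prod_f_R0 u n] has
   n + 1 factors and so cannot express an empty product. *)
Definition prod_1_n (u : nat -> R) (n : nat) : R :=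
  fold_right Rmult 1 (map u (seq 1 n)).

Definition q_gamma_ratio (q : R) (r s : nat) (a b : nat -> R) (x : R) : R :=
  prod_1_n (fun i => q_gamma q (x + a i)) r
  / prod_1_n (fun j => q_gamma q (x + b j)) s.

Definition log_ratio_deriv
    (q : R) (r s : nat) (a b : nat -> R) (n : nat) (x : R) : R :=
  Derive_n (fun t => ln (q_gamma_ratio q r s a b t)) n x.

(* [sum_n_m u 1 n] is u 1 + ... + u n, equal to 0 when n = 0. *)
Definition Upsilon (q : R) (r s : nat) (a b : nat -> R) : R :=
  sum_n_m (fun i => Rpower q (a i)) 1 r - sum_n_m (fun j => Rpower q (b j)) 1 s.

Definition monotone_beyond (M : R) (g : R -> R) : Prop :=
  (forall x y, M < x -> x <= y -> g x <= g y) \/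
  (forall x y, M < x -> x <= y -> g y <= g x).

(* Main.v *)
Require Import Defs.
From Stdlib Require Import Reals.
From Coquelicot Require Import Coquelicot.
From Stdlib Require Import Lra Lia List Classical.
Open Scope R_scope.

(** Put [y = q^x].  Expanding [log (1 - y q^k)] for every [k] shows that
    [log (q^x; q)_oo] is, up to sign, the power series with coefficients
    [1 / (m (1 - q^m))] in [y].  Hence [log f] is an affine function of [x] plus
    the power series in [y] with coefficients [Y_m / (m (1 - q^m))], where
    [Y_m = sum_i q^(m a_i) - sum_j q^(m b_j)], so that [Y_1] is Upsilon.  As
    [d/dx] acts as [ln q * y d/dy], for [n >= 2] the derivative [F_n] is
    [(ln q)^n] times a power series in [y] without constant term, and for large
    [x] its sign is that of its first nonzero coefficient.  Monotonicity of [F_n]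
    follows from the constant sign of [F_(n+1)]. *)

(** * Power series converging in the unit disk *)

Lemma CV_radius_ge_1 (c : nat -> R) (M : R) :
  (forall m, Rabs (c m) <= M) -> Rbar_le 1 (CV_radius c).
Proof.
  intros HM.
  destruct (CV_radius_bounded c) as [Hub _].
  apply Hub. exists M. intros m. rewrite pow1, Rmult_1_r. apply HM.
Qed.

Lemma unit_disk_CV (c : nat -> R) (y : R) :
  Rbar_le 1 (CV_radius c) -> -1 < y < 1 -> Rbar_lt (Rabs y) (CV_radius c).
Proof.
  intros Hc Hy. apply Rbar_lt_le_trans with (Finite 1); [|exact Hc].
  simpl. apply Rabs_def1; lra.
Qed.

(** Multiplying the m-th coefficient by m is the operator y d/dy: termwise differentiation followed
    by a shift, neither of which changes the radius. *)
Lemma CV_radius_mult_INR (c : nat -> R) :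
  CV_radius (fun m => INR m * c m) = CV_radius c.
Proof.
  rewrite <- (CV_radius_derive c), <- (CV_radius_incr_1 (PS_derive c)).
  apply CV_radius_ext. intros [|m]; unfold PS_incr_1, PS_derive; simpl;
    [unfold zero; simpl; ring | reflexivity].
Qed.

Lemma PSeries_mult_INR (c : nat -> R) (y : R) :
  PSeries (fun m => INR m * c m) y = y * PSeries (PS_derive c) y.
Proof.
  rewrite <- PSeries_incr_1. apply PSeries_ext.
  intros [|m]; unfold PS_incr_1, PS_derive; simpl;
    [unfold zero; simpl; ring | reflexivity].
Qed.

Lemma CV_radius_mult_INR_pow (c : nat -> R) (n : nat) :
  CV_radius (fun m => INR m ^ n * c m) = CV_radius c.
Proof.
  induction n as [|n IH].
  - apply CV_radius_ext. intros m. simpl. ring.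
  - rewrite <- IH, <- (CV_radius_mult_INR (fun m => INR m ^ n * c m)).
    apply CV_radius_ext. intros m. simpl. ring.
Qed.

(** Factoring out y^k leaves a series that is continuous at 0 with value [c k]. For small y it stays
    within |c k| of that value and so keeps its sign. *)
Lemma PSeries_sign_near_0 (c : nat -> R) (k : nat) :
  Rbar_le 1 (CV_radius c) -> (forall j, (j < k)%nat -> c j = 0) -> c k <> 0 ->
  exists d : R, 0 < d /\
    forall y, 0 < y < d -> sign (PSeries c y) = sign (c k).
Proof.
  intros Hc Hz Hk.
  assert (Hr : CV_radius (PS_decr_n c k) = CV_radius c).
  { clear Hc Hz Hk. induction k as [|k IH].
    - reflexivity.
    - rewrite <- IH, <- (CV_radius_decr_1 (PS_decr_n c k)).
      apply CV_radius_ext. intros m. unfold PS_decr_1, PS_decr_n.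
      f_equal. lia. }
  assert (Hcont : continuity_pt (PSeries (PS_decr_n c k)) 0).
  { apply PSeries_continuity, unit_disk_CV; [rewrite Hr; exact Hc | lra]. }
  destruct (Hcont (Rabs (c k)) (Rabs_pos_lt _ Hk)) as [d [Hd Hlim]].
  exists d. split; [exact Hd|]. intros y Hy.
  rewrite (PSeries_decr_n_aux c k y Hz), sign_mult,
    (sign_eq_1 (y ^ k)) by (apply pow_lt; lra).
  rewrite Rmult_1_l.
  assert (Hclose : Rabs (PSeries (PS_decr_n c k) y - c k) < Rabs (c k)).
  { replace (c k) with (PSeries (PS_decr_n c k) 0) at 1.
    - apply (Hlim y). split.
      + split; [exact I | lra].
      + simpl. unfold Rdist. rewrite Rabs_pos_eq; lra.
    - rewrite PSeries_0. unfold PS_decr_n. f_equal. lia. }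
  destruct (Rlt_or_le 0 (c k)) as [Hp|Hn].
  - rewrite (Rabs_pos_eq (c k)) in Hclose by lra. apply Rabs_def2 in Hclose.
    rewrite !sign_eq_1; lra.
  - rewrite (Rabs_left1 (c k)) in Hclose by lra. apply Rabs_def2 in Hclose.
    rewrite !sign_eq_m1; lra.
Qed.

(** Serves where the position of the first nonzero coefficient is unknown: [sg] is the sign of that
    coefficient, or 0 if all of them vanish. *)
Lemma PSeries_sign_const_near_0 (c : nat -> R) :
  Rbar_le 1 (CV_radius c) ->
  exists d sg : R, 0 < d /\ forall y, 0 < y < d -> sign (PSeries c y) = sg.
Proof.
  intros Hc.
  destruct (classic (exists k, c k <> 0)) as [[k Hk]|Hnone].
  - assert (Hmin : exists k0, c k0 <> 0 /\ forall j, (j < k0)%nat -> c j = 0).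
    (* The least index of a nonzero coefficient, by strong induction and excluded middle. *)
    { induction k as [k IH] using (well_founded_induction Wf_nat.lt_wf).
      destruct (classic (exists j, (j < k)%nat /\ c j <> 0)) as [[j [Hj Hcj]]|Hno].
      - exact (IH j Hj Hcj).
      - exists k. split; [exact Hk|]. intros j Hj.
        apply NNPP. intros Hcj. apply Hno. exists j. split; assumption. }
    destruct Hmin as [k0 [Hk0 Hz]].
    destruct (PSeries_sign_near_0 c k0 Hc Hz Hk0) as [d [Hd Hs]].
    exists d, (sign (c k0)). split; assumption.
  - exists 1, 0. split; [lra|]. intros y _.
    rewrite (PSeries_ext c (fun _ => 0)), PSeries_const_0, sign_0; [reflexivity|].
    intros m. apply NNPP. intros Hm. apply Hnone. exists m. exact Hm.
Qed.

(** The sum [h] of logarithm and series has derivative 0 on [0, 1), by the geometric series, and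
    vanishes at 0, so the mean value theorem makes it 0. *)
Lemma ln_1_minus_PSeries (y : R) :
  0 <= y < 1 -> ln (1 - y) = - PSeries (PS_Int (fun _ => 1)) y.
Proof.
  intros Hy.
  assert (H1 : Rbar_le 1 (CV_radius (fun _ : nat => 1))).
  { apply (CV_radius_ge_1 _ 1). intros _. rewrite Rabs_R1. lra. }
  set (h := fun t => ln (1 - t) + PSeries (PS_Int (fun _ => 1)) t).
  assert (Hh : forall t, 0 <= t < 1 -> is_derive h t 0).
  { intros t Ht.
    assert (Hin : -1 < t < 1) by lra.
    replace 0 with (plus (- / (1 - t)) (PSeries (PS_derive (PS_Int (fun _ => 1))) t)).
    - apply (is_derive_plus (fun t => ln (1 - t)) (PSeries (PS_Int (fun _ => 1)))).
      + auto_derive; [lra | field; lra].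
      + apply is_derive_PSeries, unit_disk_CV; [rewrite CV_radius_Int; exact H1 | exact Hin].
    - rewrite (PSeries_ext _ (fun _ => 1)).
      + unfold PSeries. rewrite (Series_ext _ (fun n => t ^ n)) by (intros; ring).
        rewrite Series_geom by (apply Rabs_def1; lra).
        unfold plus; simpl. ring.
      + intros m. change (INR (S m) * (1 / INR (S m)) = 1).
        field. apply not_0_INR. lia. }
  destruct (MVT_gen h 0 y (fun _ => 0)) as [t [_ Ht]].
  - intros t. rewrite Rmin_left, Rmax_right by lra. intros Ht. apply Hh. lra.
  - intros t. rewrite Rmin_left, Rmax_right by lra. intros Ht.
    apply derivable_continuous_pt. exists 0. apply is_derive_Reals, Hh. lra.
  - unfold h in Ht. rewrite PSeries_0 in Ht.
    replace (1 - 0) with 1 in Ht by ring. rewrite ln_1 in Ht. simpl in Ht. lra.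
Qed.

(** * The logarithm of the q-gamma function *)

Section QGamma.

Variable q : R.
Hypothesis hq : 0 < q < 1.

Lemma pow_S_le_base (m : nat) : q ^ S m <= q.
Proof.
  assert (q ^ m <= 1) by (rewrite <- (pow1 m); apply pow_incr; lra).
  simpl. nra.
Qed.

(** The value 0 at m = 0 removes the constant term, so that [qlog] vanishes at 0, the point towards
    which the infinite product telescopes. *)
Definition qlog_coef (m : nat) : R :=
  match m with O => 0 | S _ => / (INR m * (1 - q ^ m)) end.

(** As q^m <= q for m >= 1, the denominator m (1 - q^m) is at least 1 - q. Positivity at m = 1 later
    identifies the sign of the first coefficient with that of [Upsilon]. *)
Lemma qlog_coef_pos (m : nat) : (1 <= m)%nat -> 0 < qlog_coef m <= / (1 - q).
Proof.
  intros Hm. destruct m as [|m]; [lia|].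
  unfold qlog_coef.
  assert (HI : 1 <= INR (S m)) by (apply (le_INR 1); lia).
  assert (Hp := pow_S_le_base m).
  split.
  - apply Rinv_0_lt_compat. nra.
  - apply Rinv_le_contravar; nra.
Qed.

Lemma qlog_coef_bound (m : nat) : Rabs (qlog_coef m) <= / (1 - q).
Proof.
  destruct m as [|m].
  - simpl. rewrite Rabs_R0. left. apply Rinv_0_lt_compat. lra.
  - assert (H := qlog_coef_pos (S m) ltac:(lia)). rewrite Rabs_pos_eq; lra.
Qed.

Lemma qlog_ex_pseries (u : nat -> R) (M y : R) :
  (forall m, Rabs (u m) <= M) -> -1 < y < 1 ->
  ex_pseries (fun m => qlog_coef m * u m) y.
Proof.
  intros Hu Hy. apply CV_radius_inside, unit_disk_CV; [|exact Hy].
  apply (CV_radius_ge_1 _ (/ (1 - q) * M)). intros m. rewrite Rabs_mult.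
  apply Rmult_le_compat; auto using Rabs_pos, qlog_coef_bound.
Qed.

(** This is -log (y; q)_oo for 0 < y < 1, a form of the quantum dilogarithm. *)
Definition qlog : R -> R := PSeries qlog_coef.

Lemma qlog_CV : Rbar_le 1 (CV_radius qlog_coef).
Proof. exact (CV_radius_ge_1 _ _ qlog_coef_bound). Qed.

Lemma PSeries_dilate (c : nat -> R) (t y : R) :
  PSeries c (y * t) = PSeries (fun m => c m * t ^ m) y.
Proof.
  apply Series_ext. intros m. rewrite Rpow_mult_distr. ring.
Qed.

(* The coefficients of [qlog] are chosen so that the product telescopes. *)
Lemma qlog_functional_eq (y : R) :
  0 <= y < 1 -> ln (1 - y) = qlog (y * q) - qlog y.
Proof.
  intros Hy. rewrite ln_1_minus_PSeries by exact Hy.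
  assert (Hin : -1 < y < 1) by lra.
  unfold qlog. rewrite PSeries_dilate.
  rewrite <- PSeries_opp, <- PSeries_minus.
  - apply PSeries_ext. intros m.
    destruct m as [|m].
    { unfold PS_opp, PS_minus, PS_plus, PS_opp, plus, opp; simpl.
      unfold opp; simpl. lra. }
    assert (Hp := pow_S_le_base m).
    change (- (1 / INR (S m)) = / (INR (S m) * (1 - q ^ S m)) * q ^ S m
                                + - / (INR (S m) * (1 - q ^ S m))).
    field. split; [lra|]. apply not_0_INR. lia.
  - apply (qlog_ex_pseries (fun m => q ^ m) 1); [|exact Hin].
    intros m. rewrite Rabs_pos_eq by (apply pow_le; lra).
    rewrite <- (pow1 m). apply pow_incr. lra.
  - apply CV_radius_inside, unit_disk_CV; [exact qlog_CV | exact Hin].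
Qed.

(** By the functional equation each factor is the exponential of a difference of consecutive values
    of [qlog] along y q^k. The partial products telescope, and y q^k tends to 0, where [qlog] is
    continuous. *)
Lemma qPochhammer_inf_qlog (y : R) :
  0 < y < 1 -> qPochhammer_inf y q = exp (- qlog y).
Proof.
  intros Hy.
  assert (Hpow : forall n, 0 <= y * q ^ n < 1).
  { intros n. assert (0 < q ^ n) by (apply pow_lt; lra).
    assert (q ^ n <= 1) by (rewrite <- (pow1 n); apply pow_incr; lra). nra. }
  assert (Hfac : forall n, 1 - y * q ^ n
                 = exp (qlog (y * q ^ S n) - qlog (y * q ^ n))).
  { intros n. replace (y * q ^ S n) with (y * q ^ n * q) by (simpl; ring).
    rewrite <- qlog_functional_eq by apply Hpow.
    rewrite exp_ln; [reflexivity|]. specialize (Hpow n). lra. }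
  (* [prod_f_R0] up to n has n + 1 factors, hence the exponent [S n] on the right. *)
  assert (Hprod : forall n, prod_f_R0 (fun k => 1 - y * q ^ k) n
                  = exp (qlog (y * q ^ S n) - qlog y)).
  { induction n as [|n IH].
    - change (1 - y * q ^ 0 = exp (qlog (y * q ^ 1) - qlog y)).
      rewrite Hfac, pow_O, Rmult_1_r. reflexivity.
    - change (prod_f_R0 (fun k => 1 - y * q ^ k) (S n)) with
        (prod_f_R0 (fun k => 1 - y * q ^ k) n * (1 - y * q ^ S n)).
      rewrite IH, Hfac, <- exp_plus. f_equal. ring. }
  unfold qPochhammer_inf.
  rewrite (Lim_seq_ext (fun n => prod_f_R0 (fun k => 1 - y * q ^ k) n) _ Hprod).
  rewrite (is_lim_seq_unique _ (Finite (exp (- qlog y)))); [reflexivity|].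
  replace (- qlog y) with (qlog 0 - qlog y) by
    (unfold qlog; rewrite PSeries_0; simpl; ring).
  apply (is_lim_seq_continuous (fun z => exp (qlog z - qlog y))
           (fun n => y * q ^ S n) 0).
  - apply (continuity_pt_comp (fun z => qlog z - qlog y) exp).
    + apply continuity_pt_minus.
      * apply PSeries_continuity, unit_disk_CV; [exact qlog_CV | lra].
      * apply continuity_pt_const. intros u v. reflexivity.
    + apply derivable_continuous_pt, derivable_pt_exp.
  - apply is_lim_seq_incr_1 with (u := fun n => y * q ^ n).
    replace (Finite 0) with (Rbar_mult (Finite y) (Finite 0)) by
      (simpl; f_equal; ring).
    apply is_lim_seq_scal_l, is_lim_seq_geom, Rabs_def1; lra.
Qed.

Lemma Rpower_q_bound (x : R) : 0 < x -> 0 < Rpower q x < 1.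
Proof.
  intros Hx. split; [apply exp_pos|].
  unfold Rpower. rewrite <- exp_0. apply exp_increasing.
  assert (ln q < 0) by (rewrite <- ln_1; apply ln_increasing; lra). nra.
Qed.

Lemma Rpower_q_bound_le (x : R) : 0 <= x -> 0 < Rpower q x <= 1.
Proof.
  intros [Hx|<-].
  - assert (H := Rpower_q_bound x Hx). lra.
  - rewrite Rpower_O; lra.
Qed.

Lemma q_gamma_exp (x : R) : 0 < x ->
  q_gamma q x = exp (qlog (Rpower q x) - qlog q + (1 - x) * ln (1 - q)).
Proof.
  intros Hx. unfold q_gamma.
  rewrite !qPochhammer_inf_qlog by first [exact hq | exact (Rpower_q_bound x Hx)].
  unfold Rpower at 2. unfold Rdiv. rewrite <- exp_Ropp, <- !exp_plus.
  f_equal. ring.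
Qed.

(** * Products and quotients of q-gamma functions *)

Definition power_sum (r : nat) (a : nat -> R) (m : nat) : R :=
  sum_n_m (fun i => Rpower q (a i) ^ m) 1 r.

Lemma power_sum_S (r : nat) (a : nat -> R) (m : nat) :
  power_sum (S r) a m = power_sum r a m + Rpower q (a (S r)) ^ m.
Proof.
  unfold power_sum. rewrite sum_n_Sm by lia. reflexivity.
Qed.

Lemma Rpower_q_pow_bound (x : R) (m : nat) :
  0 <= x -> Rabs (Rpower q x ^ m) <= 1.
Proof.
  intros Hx. assert (H := Rpower_q_bound_le x Hx).
  rewrite Rabs_pos_eq by (apply pow_le; lra).
  rewrite <- (pow1 m). apply pow_incr. lra.
Qed.

Lemma power_sum_bound (r : nat) (a : nat -> R) (m : nat) :
  (forall i : nat, (1 <= i <= r)%nat -> 0 <= a i) ->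
  Rabs (power_sum r a m) <= INR r.
Proof.
  induction r as [|r IH]; intros Ha.
  - unfold power_sum. rewrite sum_n_m_zero by lia.
    unfold zero; simpl. rewrite Rabs_R0. lra.
  - rewrite power_sum_S, S_INR.
    eapply Rle_trans; [apply Rabs_triang|]. apply Rplus_le_compat.
    + apply IH. intros i Hi. apply Ha. lia.
    + apply Rpower_q_pow_bound, Ha. lia.
Qed.

(** Each factor contributes to the exponent an affine function of x and the [qlog] series dilated by
    q^(a_i). Adding the dilated series produces the power sums. *)
Lemma prod_q_gamma_exp (r : nat) (a : nat -> R) :
  (forall i : nat, (1 <= i <= r)%nat -> 0 <= a i) ->
  exists A B : R, forall x, 0 < x ->
    prod_1_n (fun i => q_gamma q (x + a i)) r
    = exp (A + B * x
           + PSeries (fun m => qlog_coef m * power_sum r a m) (Rpower q x)).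
Proof.
  induction r as [|r IH]; intros Ha.
  - exists 0, 0. intros x Hx.
    rewrite (PSeries_ext _ (fun _ => 0)), PSeries_const_0.
    + rewrite Rmult_0_l, !Rplus_0_r, exp_0. reflexivity.
    + intros m. unfold power_sum. rewrite sum_n_m_zero by lia.
      unfold zero; simpl. ring.
  - destruct IH as [A [B HAB]]; [intros i Hi; apply Ha; lia|].
    exists (A - qlog q + (1 - a (S r)) * ln (1 - q)), (B - ln (1 - q)).
    intros x Hx.
    assert (Har : 0 <= a (S r)) by (apply Ha; lia).
    assert (Hy := Rpower_q_bound x Hx).
    (* The new factor enters at the end of the list, innermost in [fold_right]; an induction on the
       list moves it outside. *)
    transitivity (prod_1_n (fun i => q_gamma q (x + a i)) r
                  * q_gamma q (x + a (S r))).
    { unfold prod_1_n. rewrite seq_S, map_app, fold_right_app. simpl.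
      generalize (map (fun i => q_gamma q (x + a i)) (seq 1 r)) as l.
      induction l as [|z l IHl]; simpl; [ring | rewrite IHl; ring]. }
    rewrite HAB by exact Hx. rewrite q_gamma_exp by lra.
    rewrite <- exp_plus. f_equal.
    rewrite Rpower_plus. unfold qlog at 1. rewrite PSeries_dilate.
    rewrite (PSeries_ext (fun m => qlog_coef m * power_sum (S r) a m)
      (PS_plus (fun m => qlog_coef m * power_sum r a m)
               (fun m => qlog_coef m * Rpower q (a (S r)) ^ m))).
    + rewrite PSeries_plus; [ring | |].
      * apply (qlog_ex_pseries _ (INR r)); [|lra].
        intros m. apply power_sum_bound. intros i Hi. apply Ha. lia.
      * apply (qlog_ex_pseries _ 1); [|lra].
        intros m. apply Rpower_q_pow_bound, Har.
    + intros m. rewrite power_sum_S. unfold PS_plus, plus; simpl. ring.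
Qed.

Definition ratio_coef (r s : nat) (a b : nat -> R) (m : nat) : R :=
  qlog_coef m * (power_sum r a m - power_sum s b m).

Lemma ln_q_gamma_ratio (r s : nat) (a b : nat -> R) :
  (forall i : nat, (1 <= i <= r)%nat -> 0 <= a i) ->
  (forall j : nat, (1 <= j <= s)%nat -> 0 <= b j) ->
  exists A B : R, forall x, 0 < x ->
    ln (q_gamma_ratio q r s a b x)
    = A + B * x + PSeries (ratio_coef r s a b) (Rpower q x).
Proof.
  intros Ha Hb.
  destruct (prod_q_gamma_exp r a Ha) as [A1 [B1 H1]].
  destruct (prod_q_gamma_exp s b Hb) as [A2 [B2 H2]].
  exists (A1 - A2), (B1 - B2). intros x Hx.
  assert (Hy := Rpower_q_bound x Hx).
  unfold q_gamma_ratio. rewrite H1, H2 by exact Hx.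
  unfold Rdiv. rewrite <- exp_Ropp, <- exp_plus, ln_exp.
  rewrite (PSeries_ext (ratio_coef r s a b)
    (PS_minus (fun m => qlog_coef m * power_sum r a m)
              (fun m => qlog_coef m * power_sum s b m))).
  - rewrite PSeries_minus; [ring | |].
    + apply (qlog_ex_pseries _ (INR r)); [|lra].
      intros m. apply power_sum_bound, Ha.
    + apply (qlog_ex_pseries _ (INR s)); [|lra].
      intros m. apply power_sum_bound, Hb.
  - intros m. unfold ratio_coef, PS_minus, PS_plus, PS_opp, plus, opp; simpl.
    unfold opp; simpl. ring.
Qed.

Lemma ratio_coef_CV (r s : nat) (a b : nat -> R) :
  (forall i : nat, (1 <= i <= r)%nat -> 0 <= a i) ->
  (forall j : nat, (1 <= j <= s)%nat -> 0 <= b j) ->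
  Rbar_le 1 (CV_radius (ratio_coef r s a b)).
Proof.
  intros Ha Hb. apply (CV_radius_ge_1 _ (/ (1 - q) * (INR r + INR s))).
  intros m. unfold ratio_coef. rewrite Rabs_mult.
  apply Rmult_le_compat; try apply Rabs_pos; [apply qlog_coef_bound|].
  eapply Rle_trans; [apply Rabs_triang|]. rewrite Rabs_Ropp.
  apply Rplus_le_compat; apply power_sum_bound; assumption.
Qed.

(** This is how [Upsilon] enters: it is the first coefficient up to a positive factor. *)
Lemma ratio_coef_1 (r s : nat) (a b : nat -> R) :
  ratio_coef r s a b 1 = qlog_coef 1 * Upsilon q r s a b.
Proof.
  unfold ratio_coef, Upsilon, power_sum. f_equal.
  f_equal; apply sum_n_m_ext; intros i; apply pow_1.
Qed.

(** * Power series in [q ^ x] *)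

Variable c : nat -> R.
Hypothesis hc : Rbar_le 1 (CV_radius c).

(** The operator (y d/dy)^n applied to the series, at y = q^x. Since 0^0 = 1, the case n = 0 is the
    series itself; for n >= 1 the constant term disappears. *)
Definition qseries (n : nat) (x : R) : R :=
  PSeries (fun m => INR m ^ n * c m) (Rpower q x).

Lemma is_derive_qseries (n : nat) (x : R) :
  0 < x -> is_derive (qseries n) x (ln q * qseries (S n) x).
Proof.
  intros Hx. assert (Hy := Rpower_q_bound x Hx).
  set (e := fun m => INR m ^ n * c m).
  replace (ln q * qseries (S n) x) with
    (scal (ln q * Rpower q x) (PSeries (PS_derive e) (Rpower q x))).
  - apply (is_derive_comp (PSeries e) (Rpower q)).
    + apply is_derive_PSeries, unit_disk_CV; [|lra].
      unfold e. rewrite CV_radius_mult_INR_pow. exact hc.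
    + unfold Rpower. auto_derive; [exact I | ring].
  - unfold qseries, scal; simpl. unfold mult; simpl.
    rewrite (PSeries_ext (fun m => INR m * INR m ^ n * c m) (fun m => INR m * e m))
      by (intros m; unfold e; ring).
    rewrite PSeries_mult_INR. ring.
Qed.

(** The first derivative reduces the affine part to [B] and the second removes it; from then on each
    derivative only multiplies by ln q and raises the index of [qseries]. *)
Lemma Derive_n_affine_qseries (g : R -> R) (A B : R) (n : nat) (x : R) :
  (forall t, 0 < t -> g t = A + B * t + PSeries c (Rpower q t)) ->
  (2 <= n)%nat -> 0 < x -> Derive_n g n x = ln q ^ n * qseries n x.
Proof.
  intros Hg Hn.
  (* The formulas hold for positive arguments only; as the half-line is open, they hold near each of
     its points, which suffices to differentiate them. *)
  assert (Hloc : forall P : R -> Prop, (forall t, 0 < t -> P t) ->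
                 forall t, 0 < t -> locally t P).
  { intros P HP t Ht. apply (filter_imp (fun u => 0 < u)); [exact HP|].
    apply open_gt. exact Ht. }
  assert (H1 : forall t, 0 < t -> Derive_n g 1 t = B + ln q * qseries 1 t).
  { intros t Ht. simpl.
    rewrite (Derive_ext_loc g (fun u => A + B * u + qseries 0 u)).
    - apply is_derive_unique.
      replace (B + ln q * qseries 1 t) with (plus B (ln q * qseries 1 t)) by reflexivity.
      apply (is_derive_plus (fun u => A + B * u) (qseries 0)).
      + auto_derive; [exact I | ring].
      + apply is_derive_qseries, Ht.
    - apply (Hloc (fun u => g u = A + B * u + qseries 0 u)); [|exact Ht].
      intros u Hu. rewrite Hg by exact Hu. unfold qseries. f_equal.
      apply PSeries_ext. intros m. simpl. ring. }
  revert x. induction Hn as [|n Hn IH]; intros x Hx.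
  - change (Derive_n g 2 x) with (Derive (Derive_n g 1) x).
    rewrite (Derive_ext_loc _ (fun u => B + ln q * qseries 1 u))
      by (apply (Hloc (fun u => Derive_n g 1 u = B + ln q * qseries 1 u) H1), Hx).
    apply is_derive_unique.
    replace (ln q ^ 2 * qseries 2 x) with
      (plus 0 (scal (ln q) (ln q * qseries 2 x))) by
      (unfold plus, scal; simpl; unfold mult; simpl; ring).
    apply (is_derive_plus (fun _ => B) (fun u => ln q * qseries 1 u)).
    + apply (is_derive_const B).
    + apply is_derive_scal, is_derive_qseries, Hx.
  - change (Derive_n g (S n) x) with (Derive (Derive_n g n) x).
    rewrite (Derive_ext_loc _ (fun u => ln q ^ n * qseries n u))
      by (apply (Hloc (fun u => Derive_n g n u = ln q ^ n * qseries n u) IH), Hx).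
    rewrite Derive_scal, (is_derive_unique _ _ _ (is_derive_qseries n x Hx)).
    simpl. ring.
Qed.

(** * Sign and monotonicity for large x *)

Lemma Rpower_q_eventually_lt (d : R) :
  0 < d -> exists M, 0 <= M /\ forall x, M < x -> 0 < Rpower q x < d.
Proof.
  (* As ln q < 0, q^x < d amounts to x > ln d / ln q; the maximum with 0 keeps the threshold
     nonnegative. *)
  intros Hd. exists (Rmax 0 (ln d / ln q)). split; [apply Rmax_l|].
  intros x Hx. split; [apply exp_pos|].
  assert (Hl : ln q < 0) by (rewrite <- ln_1; apply ln_increasing; lra).
  assert (Hx' : ln d / ln q < x) by (eapply Rle_lt_trans; [apply Rmax_r | exact Hx]).
  rewrite <- (exp_ln d Hd). apply exp_increasing.
  replace (ln d) with (ln d / ln q * ln q) by (field; lra).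
  apply Rmult_lt_gt_compat_neg_l with (r := ln q) in Hx'; lra.
Qed.

(** The derivative [dg] is a constant times the next [qseries], whose sign is constant for small
    q^x. The mean value theorem turns this into monotonicity, whichever coefficient comes first. *)
Lemma qseries_monotone_beyond (n : nat) (g : R -> R) :
  (forall x, 0 < x -> g x = ln q ^ n * qseries n x) ->
  exists M, 0 <= M /\ monotone_beyond M g.
Proof.
  intros Hg.
  set (dg := fun x => ln q ^ S n * qseries (S n) x).
  destruct (PSeries_sign_const_near_0 (fun m => INR m ^ S n * c m))
    as [d [sg [Hd Hs]]]; [rewrite CV_radius_mult_INR_pow; exact hc|].
  destruct (Rpower_q_eventually_lt d Hd) as [M [HM Hlt]].
  exists M. split; [exact HM|].
  assert (Hsign : forall x, M < x -> sign (dg x) = sign (ln q ^ S n) * sg).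
  { intros x Hx. unfold dg, qseries. rewrite sign_mult, Hs; auto. }
  assert (Hmvt : forall x y, M < x -> x <= y ->
                 exists z, M < z /\ g y - g x = dg z * (y - x)).
  { intros x y Hx Hxy.
    assert (Hder : forall t, x <= t ->
              is_derive (fun u => ln q ^ n * qseries n u) t (dg t)).
    { intros t Ht. unfold dg.
      replace (ln q ^ S n * qseries (S n) t) with
        (scal (ln q ^ n) (ln q * qseries (S n) t)) by
        (unfold scal; simpl; unfold mult; simpl; ring).
      apply is_derive_scal, is_derive_qseries. lra. }
    rewrite !Hg by lra.
    destruct (MVT_gen (fun u => ln q ^ n * qseries n u) x y dg) as [z [Hz Heq]].
    - intros t. rewrite Rmin_left by exact Hxy. intros Ht. apply Hder. lra.
    - intros t. rewrite Rmin_left by exact Hxy. intros Ht.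
      apply derivable_continuous_pt. exists (dg t). apply is_derive_Reals, Hder. lra.
    - rewrite Rmin_left in Hz by exact Hxy. exists z. split; [lra | exact Heq]. }
  destruct (Rle_or_lt 0 (sign (ln q ^ S n) * sg)) as [Hp|Hn].
  - left. intros x y Hx Hxy. destruct (Hmvt x y Hx Hxy) as [z [Hz Heq]].
    assert (0 <= dg z).
    { apply Rnot_lt_le. intros Hneg. apply sign_eq_m1 in Hneg.
      rewrite Hsign in Hneg by exact Hz. lra. }
    nra.
  - right. intros x y Hx Hxy. destruct (Hmvt x y Hx Hxy) as [z [Hz Heq]].
    assert (dg z <= 0).
    { apply Rnot_lt_le. intros Hpos. apply sign_eq_1 in Hpos.
      rewrite Hsign in Hpos by exact Hz. lra. }
    nra.
Qed.

Lemma qseries_sign (n : nat) :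
  (1 <= n)%nat -> c 1%nat <> 0 ->
  exists M, 0 <= M /\ forall x, M < x -> sign (qseries n x) = sign (c 1%nat).
Proof.
  intros Hn H1.
  destruct (PSeries_sign_near_0 (fun m => INR m ^ n * c m) 1) as [d [Hd Hs]].
  - rewrite CV_radius_mult_INR_pow. exact hc.
  (* Only j = 0 lies below 1, and there the factor 0^n vanishes because n >= 1. *)
  - intros j Hj. replace j with 0%nat by lia. rewrite pow_i by lia. ring.
  - change (INR 1) with 1. rewrite pow1. lra.
  - change (INR 1) with 1 in Hs. rewrite pow1, Rmult_1_l in Hs.
    destruct (Rpower_q_eventually_lt d Hd) as [M [HM Hlt]].
    exists M. split; [exact HM|]. intros x Hx. apply Hs, Hlt, Hx.
Qed.

End QGamma.

(** Monotonicity is claimed for every [Upsilon], the sign only for nonzero [Upsilon]: if [Upsilon]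
    vanishes, a later coefficient may give F_n a nonzero sign. *)
Theorem proposition2p4 (q : R) (r s : nat) (a b : nat -> R)
    (hq : 0 < q < 1)
    (ha : forall i : nat, (1 <= i <= r)%nat -> 0 <= a i)
    (hb : forall j : nat, (1 <= j <= s)%nat -> 0 <= b j) :
  forall n : nat, (2 <= n)%nat ->
    exists M : R, 0 <= M /\
      monotone_beyond M (log_ratio_deriv q r s a b n) /\
      (Upsilon q r s a b <> 0 ->
        forall x : R, M < x ->
          sign (log_ratio_deriv q r s a b n x)
          = sign (Upsilon q r s a b * ln q ^ n)).
Proof.
  intros n Hn.
  set (c := ratio_coef q r s a b).
  assert (Hc : Rbar_le 1 (CV_radius c)) by exact (ratio_coef_CV q hq r s a b ha hb).
  destruct (ln_q_gamma_ratio q hq r s a b ha hb) as [A [B HAB]].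
  assert (HF : forall x, 0 < x ->
            log_ratio_deriv q r s a b n x = ln q ^ n * qseries q c n x).
  { intros x Hx. exact (Derive_n_affine_qseries q hq c Hc _ A B n x HAB Hn Hx). }
  destruct (qseries_monotone_beyond q hq c Hc n _ HF) as [M1 [HM1 Hmono]].
  (* The threshold is chosen before [Upsilon] is known to be nonzero, so the vanishing case also
     needs a value; 0 serves, the claim being vacuous. *)
  assert (Hsign : exists M2, 0 <= M2 /\ (Upsilon q r s a b <> 0 ->
            forall x, M2 < x -> sign (qseries q c n x) = sign (Upsilon q r s a b))).
  { destruct (Req_dec (Upsilon q r s a b) 0) as [H0|H0].
    - exists 0. split; [lra | contradiction].
    - assert (Hd := qlog_coef_pos q hq 1 ltac:(lia)).
      destruct (qseries_sign q hq c Hc n) as [M2 [HM2 Hs]]; [lia | |].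
      + unfold c. rewrite ratio_coef_1.
        apply Rmult_integral_contrapositive_currified; lra.
      + exists M2. split; [exact HM2|]. intros _ x Hx.
        rewrite (Hs x Hx). unfold c.
        rewrite ratio_coef_1, sign_mult, sign_eq_1 by lra. ring. }
  destruct Hsign as [M2 [HM2 Hs]].
  exists (Rmax M1 M2).
  assert (Hl := Rmax_l M1 M2). assert (Hr := Rmax_r M1 M2).
  split; [lra|]. split.
  - destruct Hmono as [Hm|Hm]; [left|right]; intros x y Hx; apply Hm; lra.
  - intros HU x Hx. rewrite HF, !sign_mult, Hs by (assumption || lra). ring.
Qed.
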